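(* Let $p\ge2$. The tightness potential $TP$ is strongly differentiable at every $\mu\in P_p(\mathbb{R}^d)$, with gradient plan (strong Fréchet subdifferential) $(\iota,4T_\mu)_\#\mu$.
   Context: $P_p(\mathbb{R}^d)$ is the set of Borel probability measures on $\mathbb{R}^d$ with finite $p$-th moment; $M_2^2(\mu)=\int\|x\|^2d\mu$; $S_\mu=\int yy^\top d\mu(y)$. The tightness potential is $TP(\mu)=\iint\big[\langle x,y\rangle^2-\tfrac1d\|x\|^2\|y\|^2\big]\,d\mu(x)\,d\mu(y)$ and the tightness operator is $T_\mu x=S_\mu x-\frac{M_2^2(\mu)}{d}x$. $\iota$ is the identity map and $(\iota,g)_\#\mu$ the pushforward of $\mu$ under $x\mapsto(x,g(x))$. Let $q=p/(p-1)$. For $\gamma\in P(\mathbb{R}^d\times\mathbb{R}^d)$ and $\nu\in P_p(\mathbb{R}^d)$, $\Gamma(\gamma,\nu)$ denotes the set of probability measures $\beta$ on $(\mathbb{R}^d)^3$ with $(\pi^1,\pi^2)_\#\beta=\gamma$ and $\pi^3_\#\beta=\nu$, and for $\mu=\pi^1_\#\gamma$, $C_{p,\beta}(\mu,\nu)=\big(\iiint\|x_1-x_3\|^p\,d\beta\big)^{1/p}$. A functional $F:P_p(\mathbb{R}^d)\to\mathbb{R}$ is strongly differentiable at $\mu$ with gradient plan $\gamma$ (where $\pi^1_\#\gamma=\mu$ and $\iint\|x_2\|^q d\gamma<\infty$) if for every $\nu\in P_p(\mathbb{R}^d)$ and every $\beta\in\Gamma(\gamma,\nu)$, $F(\nu)-F(\mu)=\iiint\langle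 x_2,x_3-x_1\rangle\,d\beta(x_1,x_2,x_3)+R_\beta$, where $|R_\beta|\le\omega(C_{p,\beta}(\mu,\nu))$ for a function $\omega$ depending only on $\mu$ with $\omega(r)/r\to0$ as $r\to0$. *)

(* Defs.v *)
From HB Require Import structures.
From mathcomp Require Import all_boot all_order all_algebra.
From mathcomp Require Import all_classical all_reals all_analysis.
Set Implicit Arguments. Unset Strict Implicit. Unset Printing Implicit Defensive.
Import Order.TTheory GRing.Theory Num.Theory numFieldNormedType.Exports.
Local Open Scope classical_set_scope.
Local Open Scope ring_scope.

Definition Rd (R : realType) (d : nat) : measurableType _ :=
  g_sigma_algebraType (open : set (set 'rV[R]_d)).

Section defs.
Variables (R : realType) (d : nat).
Local Notation V := 'rV[R]_d.

Definition ip (x y : V) : R := \sum_(i < d) x 0 i * y 0 i.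
Definition enorm (x : V) : R := Num.sqrt (ip x x).

Definition finite_pmoment (p : R) (mu : probability (Rd R d) R) : Prop :=
  (\int[mu]_x ((enorm (x : V)) `^ p)%:E < +oo)%E.

Definition M22 (mu : probability (Rd R d) R) : R :=
  fine (\int[mu]_y ((enorm (y : V)) ^+ 2)%:E).

Definition Smat (mu : probability (Rd R d) R) : 'M[R]_d :=
  \matrix_(i < d, j < d) fine (\int[mu]_y (((y : V) 0 i) * ((y : V) 0 j))%:E).

Definition Top (mu : probability (Rd R d) R) (x : V) : V :=
  (Smat mu *m x^T)^T - (M22 mu / d%:R) *: x.

Definition TP (mu : probability (Rd R d) R) : R :=
  fine (\int[mu]_x \int[mu]_y
          ((ip (x : V) (y : V)) ^+ 2
           - (d%:R)^-1 * (enorm (x : V)) ^+ 2 * (enorm (y : V)) ^+ 2)%:E).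

Definition Cpb (p : R) (beta : probability ((Rd R d * Rd R d) * Rd R d)%type R) : R :=
  (fine (\int[beta]_z ((enorm ((z.1.1 : V) - (z.2 : V))) `^ p)%:E)) `^ (p^-1).

(* Strong differentiability of F at mu with gradient plan gam (Definition in
   the context).  Triples (x1,x2,x3) are encoded as ((x1,x2),x3), so that
   (pi^1,pi^2)_# beta is the image under fst and pi^3_# beta under snd. *)
Definition strongly_differentiable (p : R)
    (F : probability (Rd R d) R -> R) (mu : probability (Rd R d) R)
    (gam : probability (Rd R d * Rd R d)%type R) : Prop :=
  let q := p / (p - 1) in
  (forall A, measurable A -> gam (fst @^-1` A) = mu A) /\
  (\int[gam]_z ((enorm (z.2 : V)) `^ q)%:E < +oo)%E /\
  exists omega : R -> R,
    (fun r => omega r / r) @ 0^'+ --> 0 /\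
    forall (nu : probability (Rd R d) R), finite_pmoment p nu ->
    forall beta : probability ((Rd R d * Rd R d) * Rd R d)%type R,
      (forall B, measurable B -> beta (fst @^-1` B) = gam B) ->
      (forall A, measurable A -> beta (snd @^-1` A) = nu A) ->
      `| F nu - F mu
         - fine (\int[beta]_z (ip (z.1.2 : V) ((z.2 : V) - (z.1.1 : V)))%:E) |
        <= omega (Cpb p beta).
End defs.

(* Main.v *)
(* [TP] is a quadratic form [b] in the second-moment matrix [S].  With
   [H = x3 - x1] under [beta], [S_nu - S_mu = D1 + D1^T + D] for
   [D1 = E[H^T x1]] and [D = E[H^T H]], so
     [TP nu - TP mu = 4 b(S_mu, D1) + 2 b(S_mu, D) + b(S_nu - S_mu, S_nu - S_mu)]
   and the first term is the integral of [<4 T_mu x1, x3 - x1>].  Since [p >= 2],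
   [E |H|^2] is bounded by [2 s^2] for every [s > 0] above [Cpb], whence
   [D1 = O(s)], [D = O(s^2)] and the remaining two terms are [O(s^2)].  Letting
   [s] decrease to [Cpb] covers the case [Cpb = 0]. *)

Require Import Defs.
From HB Require Import structures.
From mathcomp Require Import all_boot all_order all_algebra.
From mathcomp Require Import all_classical all_reals all_analysis.
From mathcomp Require Import measurable_realfun ring lra.
Set Implicit Arguments. Unset Strict Implicit. Unset Printing Implicit Defensive.
Import Order.TTheory GRing.Theory Num.Theory numFieldNormedType.Exports.
Local Open Scope classical_set_scope.
Local Open Scope ring_scope.

(* The bilinear form with TP mu = bform (Smat mu) (Smat mu). *)
Definition bform (R : realType) (d : nat) (M N : 'M[R]_d) : R :=
  \sum_i \sum_j (M - (\tr M / d%:R)%:M) i j * N i j.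

(** * Algebra of the trace-corrected bilinear form on matrices *)

Section bform.
Variables (R : realType) (d : nat).
Implicit Types M N : 'M[R]_d.

(** The correction by [\tr M / d] meets only the diagonal of [N], so it contributes a multiple of
    [\tr N]. In this shape the symmetry of [bform] is visible. *)
Lemma bformE M N :
  bform M N = \sum_i \sum_j M i j * N i j - d%:R^-1 * \tr M * \tr N.
Proof.
rewrite /bform [\tr N]/mxtrace mulr_sumr -sumrB; apply: eq_bigr => i _.
rewrite (bigD1 i)//= [X in _ = X - _](bigD1 i)//= !mxE eqxx mulr1n.
rewrite mulrBl addrAC [d%:R^-1 * _]mulrC; congr (_ + _ - _).
by apply: eq_bigr => j ji; rewrite !mxE eq_sym (negPf ji) mulr0n subr0.
Qed.

Lemma bformC M N : bform M N = bform N M.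
Proof.
rewrite !bformE mulrAC; congr (_ - _).
by apply: eq_bigr => i _; apply: eq_bigr => j _; rewrite mulrC.
Qed.

Lemma bform_tr M N : bform M^T N^T = bform M N.
Proof.
rewrite !bformE !mxtrace_tr exchange_big/=; congr (_ - _).
by apply: eq_bigr => i _; apply: eq_bigr => j _; rewrite !mxE.
Qed.

Lemma bformDr M N1 N2 :
  bform M (N1 + N2) = bform M N1 + bform M N2.
Proof.
rewrite /bform -big_split/=; apply: eq_bigr => i _.
by rewrite -big_split/=; apply: eq_bigr => j _; rewrite [(N1 + N2) _ _]mxE mulrDr.
Qed.

(** The double sum has [d ^ 2] terms of size at most [a * b]; each trace costs a factor [d], one of
    which cancels against [d^-1]. *)
Lemma bform_le M N a b : (forall i j, `|M i j| <= a) ->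
    (forall i j, `|N i j| <= b) ->
  `|bform M N| <= (d%:R ^+ 2 + d%:R) * (a * b).
Proof.
move=> Ma Nb; rewrite bformE mulrDl.
have trle (P : 'M[R]_d) c : (forall i j, `|P i j| <= c) -> `|\tr P| <= d%:R * c.
  move=> Pc; rewrite (le_trans (ler_norm_sum _ _ _))//.
  by rewrite (le_trans (ler_sum _ (fun i _ => Pc i i)))// sumr_const card_ord mulr_natl.
rewrite (le_trans (ler_normB _ _))// lerD//.
  rewrite (le_trans (ler_norm_sum _ _ _))//.
  apply: (@le_trans _ _ (\sum_(i < d) \sum_(j < d) a * b)).
    apply: ler_sum => i _; rewrite (le_trans (ler_norm_sum _ _ _))//.
    by apply: ler_sum => j _; rewrite normrM ler_pM.
  by rewrite !sumr_const card_ord -mulrnA -[leLHS]mulr_natl natrM expr2.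
(* For [d = 0] the convention [0^-1 = 0] makes both sides vanish; otherwise [d^-1] is a true
   inverse. *)
have [d0|d0] := posnP d.
  by rewrite [X in X%:R^-1]d0 invr0 !mul0r normr0 [X in X%:R]d0 mul0r.
have dn0 : d%:R != 0 :> R by rewrite pnatr_eq0 -lt0n.
rewrite 2!normrM ger0_norm ?invr_ge0//.
have -> : d%:R * (a * b) = d%:R^-1 * (d%:R * a) * (d%:R * b).
  by field.
by rewrite ler_pM ?mulr_ge0 ?invr_ge0// ?ler_wpM2l ?invr_ge0 ?trle.
Qed.

(** For [M = Smat mu] the matrix on the left is that of [T_mu]; the gradient pairing thereby becomes
    a value of [bform] on a rank-one matrix. *)
Lemma ip_dev M (x h : 'rV[R]_d) :
  ip (((M - (\tr M / d%:R)%:M) *m x^T)^T) h = bform M (h^T *m x).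
Proof.
rewrite /ip /bform; apply: eq_bigr => i _; rewrite !mxE mulr_suml.
apply: eq_bigr => j _; rewrite [x^T _ _]mxE [(h^T *m x) _ _]mxE big_ord1 [h^T _ _]mxE.
by rewrite -mulrA [x _ _ * _]mulrC.
Qed.

(** As [A] is symmetric, [D1] and [D1^T] pair equally with it. This doubling and the one from
    expanding the quadratic form give the factor 4. *)
Lemma bform_expansion (A D1 D : 'M[R]_d) : A^T = A ->
  let E := D1 + D1^T + D in
  bform (A + E) (A + E) - bform A A - 4 * bform A D1 =
  2 * bform A D + bform E E.
Proof.
move=> AT E.
have AD1 : bform A D1^T = bform A D1 by rewrite -{1}AT bform_tr.
have AE : bform A E = 2 * bform A D1 + bform A D.
  by rewrite /E 2!bformDr AD1; ring.
rewrite bformDr 2!(bformC (A + E)) 2!bformDr (bformC E A) AE; ring.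
Qed.

End bform.

(** * Elementary inequalities for the Euclidean inner product and norm *)

Section ip.
Variables (R : realType) (d : nat).
Implicit Types x y : 'rV[R]_d.

Lemma ip_ge0 x : 0 <= ip x x.
Proof. by apply: sumr_ge0 => i _; rewrite -expr2 sqr_ge0. Qed.

Lemma coord_sqr_le_ip x i : x 0 i ^+ 2 <= ip x x.
Proof.
rewrite /ip (bigD1 i)//= -expr2 lerDl.
by apply: sumr_ge0 => j _; rewrite -expr2 sqr_ge0.
Qed.

Lemma ip_subr_le x y : ip (x - y) (x - y) <= 2 * (ip x x + ip y y).
Proof.
rewrite /ip -big_split/= mulr_sumr; apply: ler_sum => i _; rewrite !mxE.
have := sqr_ge0 (x 0 i + y 0 i); nra.
Qed.

Lemma enorm_ge0 x : 0 <= enorm x. Proof. exact: sqrtr_ge0. Qed.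

Lemma sqr_enorm x : enorm x ^+ 2 = ip x x.
Proof. by rewrite sqr_sqrtr// ip_ge0. Qed.

Lemma enorm_subr_le x y : enorm (x - y) <= 2 * Num.max (enorm x) (enorm y).
Proof.
have xM : enorm x <= Num.max (enorm x) (enorm y) by rewrite le_max lexx.
have yM : enorm y <= Num.max (enorm x) (enorm y) by rewrite le_max lexx orbT.
set m := Num.max _ _ in xM yM *.
have m0 : 0 <= m by rewrite (le_trans (enorm_ge0 x)).
rewrite -(@ler_pXn2r _ 2)// ?nnegrE ?mulr_ge0 ?enorm_ge0// sqr_enorm.
rewrite (le_trans (ip_subr_le _ _))// -!sqr_enorm.
have := enorm_ge0 x; have := enorm_ge0 y; nra.
Qed.

End ip.

Lemma sqr_le_1D_powR (R : realType) (p u : R) : 2 <= p -> 0 <= u ->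
  u ^+ 2 <= 1 + u `^ p.
Proof.
move=> p2 u0; have [u1|/ltW u1] := leP u 1.
  by rewrite (@le_trans _ _ 1)// ?exprn_ile1// lerDl powR_ge0.
by rewrite -powR_mulrn// (le_trans (ler_powR u1 p2))// lerDr.
Qed.

(** * Real-valued integrals against a probability measure *)

Section probability_integrals.
Context dT (T : measurableType dT) (R : realType) (P : probability T R).
Local Notation integrable f := (P.-integrable [set: T] (EFin \o f)).

Lemma integrable_le (f g : T -> R) : measurable_fun setT f ->
  (forall t, `|f t| <= g t) -> integrable g -> integrable f.
Proof.
move=> mf fg; apply: le_integrable => //; first exact/measurable_EFinP.
by move=> t _; rewrite lee_fin (le_trans (fg t))// ler_norm.
Qed.

Lemma integrable_EFinD (f g : T -> R) :
  integrable f -> integrable g -> integrable (fun t => f t + g t).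
Proof. by move=> fi gi; exact: (integrableD measurableT fi gi). Qed.

Lemma integrable_EFinZ (c : R) (f : T -> R) :
  integrable f -> integrable (fun t => c * f t).
Proof. by move=> fi; exact: (integrableZl measurableT c fi). Qed.

Lemma integrable_EFin_cst (c : R) : integrable (fun=> c).
Proof. exact: (finite_measure_integrable_cst P). Qed.

Lemma integrable_EFin_sum (I : Type) (s : seq I) (f : I -> T -> R) :
  (forall i, integrable (f i)) -> integrable (fun t => \sum_(i <- s) f i t).
Proof.
move=> fi.
rewrite (_ : EFin \o _ = fun t => (\sum_(i <- s) (EFin \o f i) t)%E).
  exact: integrable_sum.
by apply/funext => t; rewrite /= sumEFin.
Qed.

Lemma Rintegral_sum (I : Type) (s : seq I) (f : I -> T -> R) :
  (forall i, integrable (f i)) ->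
  \int[P]_t (\sum_(i <- s) f i t) = \sum_(i <- s) \int[P]_t f i t.
Proof.
move=> fi; elim: s => [|i s IH].
  by under eq_Rintegral do rewrite big_nil; rewrite Rintegral_cst// mul0r big_nil.
under eq_Rintegral do rewrite big_cons.
by rewrite big_cons RintegralD// ?IH//; exact: integrable_EFin_sum.
Qed.

Lemma Rintegral_cst_probability (c : R) : \int[P]_t c = c.
Proof.
rewrite Rintegral_cst// (_ : fine _ = 1) ?mulr1//.
exact: (congr1 fine (probability_setT P)).
Qed.

Lemma EFin_Rintegral (f : T -> R) : integrable f ->
  (\int[P]_t (f t)%:E)%E = (\int[P]_t f t)%:E.
Proof. by move=> fi; rewrite fineK//; exact: (integrable_fin_num measurableT fi). Qed.

Lemma integrable_bform d (M : 'M[R]_d) (N : T -> 'M[R]_d) :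
  (forall i j, integrable (fun t => N t i j)) ->
  integrable (fun t => bform M (N t)).
Proof.
move=> Ni; apply: integrable_EFin_sum => i; apply: integrable_EFin_sum => j.
exact: integrable_EFinZ.
Qed.

Lemma Rintegral_bform d (M : 'M[R]_d) (N : T -> 'M[R]_d) :
  (forall i j, integrable (fun t => N t i j)) ->
  \int[P]_t bform M (N t) = bform M (\matrix_(i, j) \int[P]_t N t i j).
Proof.
move=> Ni; rewrite /bform Rintegral_sum => [|i]; last first.
  by apply: integrable_EFin_sum => j; exact: integrable_EFinZ.
apply: eq_bigr => i _; rewrite Rintegral_sum => [|j]; last exact: integrable_EFinZ.
by apply: eq_bigr => j _; rewrite RintegralZl//; congr (_ * _); rewrite mxE.
Qed.

Lemma Rintegral_normr_le (f g : T -> R) : measurable_fun setT f ->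
  (forall t, `|f t| <= g t) -> integrable g ->
  `|\int[P]_t f t| <= \int[P]_t g t.
Proof.
move=> mf fg gi; have fi := integrable_le mf fg gi.
rewrite (le_trans (le_normr_Rintegral measurableT fi))// le_Rintegral//.
apply: (integrable_le _ _ gi) => [|t]; first exact: measurableT_comp.
by rewrite normr_id.
Qed.

End probability_integrals.

(** * Square-integrable random vectors *)

Section square_integrable.
Context dT (T : measurableType dT) (R : realType) (P : probability T R).
Context (d : nat).
Implicit Types X Y H : T -> 'rV[R]_d.
Local Notation integrable f := (P.-integrable [set: T] (EFin \o f)).

(** Working by coordinates reduces vector-valued measurability to real functions, where sums and
    products are at hand. *)
Definition measurable_coords X :=
  forall i, measurable_fun [set: T] (fun t => X t 0 i).

Definition sq_integrable X :=
  measurable_coords X /\ integrable (fun t => ip (X t) (X t)).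

Lemma measurable_ip X Y : measurable_coords X -> measurable_coords Y ->
  measurable_fun [set: T] (fun t => ip (X t) (Y t)).
Proof. by move=> mX mY; apply: measurable_sum => i; exact: measurable_funM. Qed.

Lemma measurable_coordsB X Y : measurable_coords X -> measurable_coords Y ->
  measurable_coords (fun t => X t - Y t).
Proof.
move=> mX mY i; under eq_fun do rewrite !mxE.
exact: measurable_funB.
Qed.

Lemma measurable_coords_mulmx (M : 'M[R]_d) X : measurable_coords X ->
  measurable_coords (fun t => (M *m (X t)^T)^T).
Proof.
move=> mX i; under eq_fun do rewrite !mxE.
apply: measurable_sum => j; under eq_fun do rewrite mxE.
exact: measurable_funM.
Qed.

Lemma measurable_enorm_powR (p : R) X : measurable_coords X ->
  measurable_fun [set: T] (fun t => enorm (X t) `^ p).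
Proof.
move=> mX; apply: (measurableT_comp (measurable_powR p)).
apply: (measurableT_comp (continuous_measurable_fun (@sqrt_continuous R))).
exact: measurable_ip.
Qed.

(** Domination by [|X|^2 + |Y|^2]. *)
Lemma sq_integrable_mul X Y i j : sq_integrable X -> sq_integrable Y ->
  integrable (fun t => X t 0 i * Y t 0 j).
Proof.
move=> [mX iX] [mY iY]; apply: (integrable_le _ _ (integrable_EFinD iX iY)).
  exact: measurable_funM.
move=> t; have := coord_sqr_le_ip (X t) i; have := coord_sqr_le_ip (Y t) j.
by move=> ? ?; rewrite ler_norml; apply/andP; split; nra.
Qed.

Lemma sq_integrableB X Y : sq_integrable X -> sq_integrable Y ->
  sq_integrable (fun t => X t - Y t).
Proof.
move=> [mX iX] [mY iY]; have mXY := measurable_coordsB mX mY; split => //.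
apply: (integrable_le _ _ (integrable_EFinZ 2 (integrable_EFinD iX iY))).
  exact: measurable_ip.
by move=> t; rewrite ger0_norm ?ip_ge0// ip_subr_le.
Qed.

(** The squared norm of the image is a finite combination of products of coordinates of [X]. It
    serves for the moment of the gradient plan. *)
Lemma sq_integrable_mulmx (M : 'M[R]_d) X : sq_integrable X ->
  sq_integrable (fun t => (M *m (X t)^T)^T).
Proof.
move=> sX; split; first exact/measurable_coords_mulmx/(proj1 sX).
apply: integrable_EFin_sum => i.
have -> : (fun t => (M *m (X t)^T)^T 0 i * (M *m (X t)^T)^T 0 i) =
    (fun t => \sum_j \sum_k (M i j * M i k) * (X t 0 j * X t 0 k)).
  apply/funext => t; rewrite !mxE mulr_suml; apply: eq_bigr => j _.
  by rewrite mulr_sumr; apply: eq_bigr => k _; rewrite !mxE mulrACA.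
apply: integrable_EFin_sum => j; apply: integrable_EFin_sum => k.
exact/integrable_EFinZ/sq_integrable_mul.
Qed.

Lemma powR_integrable_sq_integrable (p : R) X : 2 <= p -> measurable_coords X ->
  integrable (fun t => enorm (X t) `^ p) -> sq_integrable X.
Proof.
move=> p2 mX iX; split => //.
apply: (integrable_le _ _ (integrable_EFinD (integrable_EFin_cst P 1) iX)).
  exact: measurable_ip.
by move=> t; rewrite ger0_norm ?ip_ge0// -sqr_enorm sqr_le_1D_powR// enorm_ge0.
Qed.

(** From [|x - y| <= 2 max(|x|, |y|)], the integrand is dominated by [2^p (|X|^p + |Y|^p)]; no
    Minkowski inequality is involved. *)
Lemma powR_integrableB (p : R) X Y : 0 <= p ->
    measurable_coords X -> measurable_coords Y ->
  integrable (fun t => enorm (X t) `^ p) -> integrable (fun t => enorm (Y t) `^ p) ->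
  integrable (fun t => enorm (X t - Y t) `^ p).
Proof.
move=> p0 mX mY iX iY.
apply: (integrable_le _ _ (integrable_EFinZ (2 `^ p) (integrable_EFinD iX iY))).
  exact/measurable_enorm_powR/measurable_coordsB.
move=> t; rewrite ger0_norm ?powR_ge0//.
have M0 : 0 <= Num.max (enorm (X t)) (enorm (Y t)) by rewrite le_max enorm_ge0.
rewrite (le_trans (ge0_ler_powR p0 _ _ (enorm_subr_le _ _)))// ?nnegrE ?enorm_ge0 ?mulr_ge0//.
rewrite powRM// ler_wpM2l ?powR_ge0//.
by case: (leP (enorm (X t))) => _; rewrite ?lerDl ?lerDr powR_ge0.
Qed.

(* Integrating [u^2 <= 1 + u^p] for [u = |H| / s] replaces Hoelder's inequality,
   at the harmless cost of the factor 2. *)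
Lemma second_moment_le (p s : R) H : 2 <= p -> 0 < s -> measurable_coords H ->
    integrable (fun t => enorm (H t) `^ p) ->
    \int[P]_t (enorm (H t) `^ p) <= s `^ p ->
  \int[P]_t ip (H t) (H t) <= 2 * s ^+ 2.
Proof.
move=> p2 s0 mH iH Hs; have [_ sH] := powR_integrable_sq_integrable p2 mH iH.
have sp0 : 0 < s `^ p by rewrite powR_gt0.
have i1 := integrable_EFin_cst P (s ^+ 2).
have i2 := integrable_EFinZ (s ^+ 2 / s `^ p) iH.
apply: (@le_trans _ _
  (\int[P]_t (s ^+ 2 + s ^+ 2 / s `^ p * enorm (H t) `^ p))); last first.
  rewrite RintegralD// RintegralZl// Rintegral_cst_probability.
  rewrite mulr_natl mulr2n lerD2l -mulrA ler_piMr ?sqr_ge0//.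
  by rewrite mulrC ler_pdivrMr// mul1r.
apply: le_Rintegral => //; first exact: integrable_EFinD.
move=> t _; rewrite -sqr_enorm.
have u0 : 0 <= enorm (H t) / s by rewrite divr_ge0 ?enorm_ge0 ?ltW.
have := sqr_le_1D_powR p2 u0.
rewrite -(ler_pM2l (exprn_gt0 2 s0)) -exprMn mulrCA divff ?gt_eqF// mulr1.
move/le_trans; apply; rewrite mulrDr mulr1 lerD2l -mulrA ler_wpM2l ?sqr_ge0//.
rewrite powRM ?enorm_ge0 ?invr_ge0 ?(ltW s0)// mulrC.
by rewrite -[s^-1]powR_inv1 ?(ltW s0)// powRAC powR_inv1 ?powR_ge0.
Qed.

End square_integrable.

(** * Change of variables when [Q] is the image of [P] under [phi] *)

Section image_measure.
Context dT (T : measurableType dT) dU (U : measurableType dU) (R : realType).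
Variables (P : probability T R) (Q : probability U R) (phi : T -> U).
Hypothesis mphi : measurable_fun [set: T] phi.
Hypothesis PQ : forall A, measurable A -> P (phi @^-1` A) = Q A.

Lemma ge0_integral_image (f : U -> R) : measurable_fun [set: U] f ->
    (forall u, 0 <= f u) ->
  (\int[Q]_u (f u)%:E = \int[P]_t (f (phi t))%:E)%E.
Proof.
move=> mf f0; rewrite (eq_measure_integral (pushforward P phi)) => [|A mA _].
  rewrite ge0_integral_pushforward ?preimage_setT//; first exact/measurable_EFinP.
  by move=> u _; rewrite lee_fin.
exact/esym/PQ.
Qed.

Lemma integrable_image (f : U -> R) : measurable_fun [set: U] f ->
    Q.-integrable [set: U] (EFin \o f) ->
  P.-integrable [set: T] (EFin \o (f \o phi)).
Proof.
move=> mf /integrableP[_ fi]; apply/integrableP; split.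
  exact/measurable_EFinP/measurableT_comp.
move: fi; rewrite (eq_integral (fun u => (`|f u|)%:E))//.
by rewrite (@ge0_integral_image (fun u => `|f u|))//; exact: measurableT_comp.
Qed.

Lemma Rintegral_image (f : U -> R) : measurable_fun [set: U] f ->
    Q.-integrable [set: U] (EFin \o f) ->
  \int[Q]_u f u = \int[P]_t f (phi t).
Proof.
move=> mf fi; rewrite /Rintegral.
rewrite (eq_measure_integral (pushforward P phi)) => [|A mA _].
  rewrite integral_pushforward ?preimage_setT//; first exact/measurable_EFinP.
  exact: integrable_image.
exact/esym/PQ.
Qed.

End image_measure.

(** * Matrices of cross moments and the second-order remainder *)

Section cross_moments.
Context dT (T : measurableType dT) (R : realType) (P : probability T R).
Context (d : nat).
Implicit Types X Y H : T -> 'rV[R]_d.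

Definition cross_moment X Y : 'M[R]_d :=
  \matrix_(i, j) \int[P]_t (X t 0 i * Y t 0 j).

Lemma cross_moment_tr X Y : (cross_moment X Y)^T = cross_moment Y X.
Proof.
by apply/matrixP => i j; rewrite !mxE; apply: eq_Rintegral => t _; rewrite mulrC.
Qed.

Lemma Rintegral_bform_cross (M : 'M[R]_d) X Y :
    sq_integrable P X -> sq_integrable P Y ->
  \int[P]_t bform M ((X t)^T *m Y t) = bform M (cross_moment X Y).
Proof.
move=> sX sY.
have E t i j : ((X t)^T *m Y t) i j = X t 0 i * Y t 0 j.
  by rewrite !mxE big_ord1 mxE.
rewrite Rintegral_bform => [|i j].
  congr bform; apply/matrixP => i j; rewrite !mxE.
  by apply: eq_Rintegral => t _; rewrite E.
under eq_fun do rewrite E.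
exact: sq_integrable_mul.
Qed.

Lemma integrable_bform_cross (M : 'M[R]_d) X Y :
    sq_integrable P X -> sq_integrable P Y ->
  P.-integrable [set: T] (EFin \o (fun t => bform M ((X t)^T *m Y t))).
Proof.
move=> sX sY; apply: integrable_bform => i j.
under eq_fun do rewrite !mxE big_ord1 mxE.
exact: sq_integrable_mul.
Qed.

(** A weighted AM-GM inequality in place of Cauchy-Schwarz. The free weight matters: if
    [E|Y|^2 = O(s^2)] while [E|X|^2] is fixed, both summands are [O(s)]. *)
Lemma cross_moment_le X Y (s : R) i j : 0 < s ->
    sq_integrable P X -> sq_integrable P Y ->
  `|cross_moment X Y i j| <=
    (s * \int[P]_t ip (X t) (X t) + s^-1 * \int[P]_t ip (Y t) (Y t)) / 2.
Proof.
move=> s0 [mX iX] [mY iY]; rewrite mxE.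
have i1 := integrable_EFinZ s iX; have i2 := integrable_EFinZ s^-1 iY.
have i12 := integrable_EFinD i1 i2.
rewrite -!RintegralZl// -RintegralD// -RintegralZr//.
apply: Rintegral_normr_le; first exact: measurable_funM.
  move=> t; have := coord_sqr_le_ip (X t) i; have := coord_sqr_le_ip (Y t) j.
  set a := X t 0 i; set b := Y t 0 j => bY aX.
  have sa : s * a ^+ 2 <= s * ip (X t) (X t) by rewrite ler_pM2l.
  have sb : s^-1 * b ^+ 2 <= s^-1 * ip (Y t) (Y t) by rewrite ler_pM2l ?invr_gt0.
  (* AM-GM: 2 |a b| <= s a^2 + b^2 / s *)
  have sqD c : 0 <= s * a ^+ 2 + s^-1 * (c * b) ^+ 2 + 2 * (a * (c * b)).
    have -> : s * a ^+ 2 + s^-1 * (c * b) ^+ 2 + 2 * (a * (c * b)) =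
      s^-1 * (s * a + c * b) ^+ 2 by field; rewrite gt_eqF.
    by rewrite mulr_ge0 ?sqr_ge0// invr_ge0 ltW.
  (* The two signs of [c] bound [a * b] from above and from below. *)
  have := sqD 1; have := sqD (-1); rewrite mul1r mulN1r sqrrN.
  by move=> ? ?; rewrite ler_norml; apply/andP; split; lra.
by rewrite (_ : EFin \o _ = EFin \o (fun t => 2^-1 *
  (s * ip (X t) (X t) + s^-1 * ip (Y t) (Y t)))) ?integrable_EFinZ//;
  apply/funext => t /=; rewrite mulrC.
Qed.

(** What survives is [2 b(A, D) + b(E, E)]. Entrywise, [A] is at most [m], [D] at most [2 s^2] and
    [E] at most [s (m + 2 + 2 s)], which yields the [4 m] and the square in the bound. *)
Lemma bform_cross_moment_remainder (s : R) X Y H : 0 < s ->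
    (forall t, Y t = X t + H t) -> sq_integrable P X -> sq_integrable P H ->
    \int[P]_t ip (H t) (H t) <= 2 * s ^+ 2 ->
  `|bform (cross_moment Y Y) (cross_moment Y Y)
    - bform (cross_moment X X) (cross_moment X X)
    - 4 * bform (cross_moment X X) (cross_moment H X)| <=
  (d%:R ^+ 2 + d%:R) *
    (4 * \int[P]_t ip (X t) (X t) + (\int[P]_t ip (X t) (X t) + 2 + 2 * s) ^+ 2)
    * s ^+ 2.
Proof.
move=> s0 YE sX sH Hs.
set A := cross_moment X X; set B := cross_moment Y Y; set m := \int[P]_t ip _ _.
have m0 : 0 <= m by apply: Rintegral_ge0 => t _; exact: ip_ge0.
pose D1 := cross_moment H X; pose D := cross_moment H H.
have BE : B = A + (D1 + D1^T + D).
  rewrite cross_moment_tr; apply/matrixP => i j; rewrite !mxE.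
  have iXX := sq_integrable_mul i j sX sX; have iHX := sq_integrable_mul i j sH sX.
  have iXH := sq_integrable_mul i j sX sH; have iHH := sq_integrable_mul i j sH sH.
  have i1 := integrable_EFinD iHX iXH; have i2 := integrable_EFinD i1 iHH.
  rewrite -!RintegralD//; apply: eq_Rintegral => t _; rewrite YE !mxE; ring.
rewrite BE bform_expansion; last exact: cross_moment_tr.
have Am i j : `|A i j| <= m.
  by rewrite (le_trans (cross_moment_le i j ltr01 sX sX))// invr1 -/m; lra.
have Ds i j : `|D i j| <= 2 * s ^+ 2.
  rewrite (le_trans (cross_moment_le i j ltr01 sH sH))// invr1; lra.
have D1s i j : `|D1 i j| <= (m + 2) * s / 2.
  (* Transposing puts the weight [s] on [X] and [s^-1] on [H], so the bound is
     [(s m + s^-1 (2 s^2)) / 2]. *)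
  rewrite /D1 -cross_moment_tr mxE (le_trans (cross_moment_le j i s0 sX sH))// -/m.
  have := Hs; rewrite -(ler_pM2l (_ : 0 < s^-1)) ?invr_gt0//.
  have -> : s^-1 * (2 * s ^+ 2) = 2 * s by field; rewrite gt_eqF.
  by move=> ?; lra.
have Es i j : `|(D1 + D1^T + D) i j| <= (m + 2) * s + 2 * s ^+ 2.
  have -> : (D1 + D1^T + D) i j = D1 i j + D1 j i + D i j by rewrite !mxE.
  rewrite (le_trans (ler_normD _ _))// lerD//.
  rewrite (le_trans (ler_normD _ _))//.
  by have := D1s i j; have := D1s j i; lra.
rewrite (le_trans (ler_normD _ _))// normrM ger0_norm//.
have b1 := bform_le Am Ds; have b2 := bform_le Es Es.
set E := bform _ (D1 + _ + _) in b2 *.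
rewrite (@le_trans _ _ (2 * ((d%:R ^+ 2 + d%:R) * (m * (2 * s ^+ 2))) +
  (d%:R ^+ 2 + d%:R) * (((m + 2) * s + 2 * s ^+ 2) * ((m + 2) * s + 2 * s ^+ 2))))//.
  by rewrite lerD// ler_pM2l.
by rewrite le_eqVlt; apply/orP; left; apply/eqP; ring.
Qed.

End cross_moments.

(** * The tightness potential and operator in terms of the second-moment matrix *)

Section tightness_potential.
Variables (R : realType) (d : nat).
Implicit Types mu : probability (Rd R d) R.
Local Notation id_Rd := (fun x : Rd R d => x : 'rV[R]_d).

(** Coordinates are continuous, so preimages of open intervals are open, hence among the generators
    of the Borel sets of [Rd]. *)
Lemma measurable_coords_Rd : measurable_coords id_Rd.
Proof.
move=> i; apply: (measurability _ (RGenOpens.measurableE R)).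
move=> _ [_ [a [b ->] <-]]; rewrite setTI.
apply: sub_sigma_algebra; apply: open_comp => [x _|]; last exact: interval_open.
exact: coord_continuous.
Qed.

Lemma measurable_coords_comp dT (T : measurableType dT) (phi : T -> Rd R d) :
  measurable_fun [set: T] phi -> measurable_coords (phi : T -> 'rV[R]_d).
Proof. by move=> mphi i; exact: (measurableT_comp (measurable_coords_Rd i) mphi). Qed.

Lemma finite_pmoment_integrable p mu : finite_pmoment p mu ->
  mu.-integrable [set: Rd R d] (EFin \o (fun x => enorm (id_Rd x) `^ p)).
Proof.
move=> hmu; apply/integrableP; split.
  apply/measurable_EFinP; apply: measurable_enorm_powR.
  exact: measurable_coords_Rd.
apply: le_lt_trans hmu; rewrite le_eqVlt; apply/orP; left; apply/eqP.
by apply: eq_integral => x _; rewrite gee0_abs// lee_fin powR_ge0.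
Qed.

Lemma SmatE mu : Smat mu = cross_moment mu id_Rd id_Rd. Proof. by []. Qed.

Lemma M22E mu : M22 mu = \int[mu]_x ip (id_Rd x) (id_Rd x).
Proof. by apply: eq_Rintegral => x _; rewrite sqr_enorm. Qed.

(** This identifies the scalar in [Top] with the trace correction inside [bform]. *)
Lemma M22_mxtrace mu : sq_integrable mu id_Rd -> M22 mu = \tr (Smat mu).
Proof.
move=> smu; rewrite M22E Rintegral_sum => [|i]; last exact: sq_integrable_mul.
by apply: eq_bigr => i _; rewrite mxE.
Qed.

(** The kernel of [TP] is [bform] on rank-one matrices, so integrating it is a matter of
    linearity. *)
Lemma bform_outer (x y : 'rV[R]_d) : bform (x^T *m x) (y^T *m y) =
  ip x y ^+ 2 - d%:R^-1 * enorm x ^+ 2 * enorm y ^+ 2.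
Proof.
have oE (z : 'rV[R]_d) i j : (z^T *m z) i j = z 0 i * z 0 j.
  by rewrite mxE big_ord1 mxE.
have trE (z : 'rV[R]_d) : \tr (z^T *m z) = ip z z by apply: eq_bigr => i _; rewrite oE.
rewrite bformE !sqr_enorm !trE; congr (_ - _); rewrite expr2 mulr_suml.
apply: eq_bigr => i _; rewrite mulr_sumr; apply: eq_bigr => j _.
by rewrite !oE mulrACA.
Qed.

Lemma TP_bform mu : sq_integrable mu id_Rd ->
  TP mu = bform (Smat mu) (Smat mu).
Proof.
move=> smu; rewrite /TP SmatE -Rintegral_bform_cross//; congr fine.
(* Integrals pass through the second argument only; symmetry lets the same rule serve for both
   variables. *)
apply: eq_integral => x _; rewrite bformC -Rintegral_bform_cross//.
rewrite -EFin_Rintegral; last exact: integrable_bform_cross.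
by apply: eq_integral => y _; rewrite bform_outer.
Qed.

Lemma TopE mu x : sq_integrable mu id_Rd ->
  Top mu x = ((Smat mu - (\tr (Smat mu) / d%:R)%:M) *m x^T)^T.
Proof.
move=> smu; rewrite /Top M22_mxtrace// mulmxBl mul_scalar_mx.
by apply/matrixP => i j; rewrite !mxE.
Qed.

End tightness_potential.

(** Counterpart of [sqr_le_1D_powR] for the conjugate exponent, which is at most 2 when [p >= 2]. *)
Lemma powR_le_1Dsqr (R : realType) (q u : R) : 0 <= q <= 2 -> 0 <= u ->
  u `^ q <= 1 + u ^+ 2.
Proof.
move=> /andP[q0 q2] u0; have [u1|/ltW u1] := leP u 1.
  have := ge0_ler_powR q0 (_ : u \is Num.nneg) (_ : 1 \is Num.nneg) u1.
  rewrite !nnegrE powR1 => /(_ u0 ler01)/le_trans; apply.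
  by rewrite lerDl sqr_ge0.
by rewrite -powR_mulrn// (le_trans (ler_powR u1 q2))// lerDr.
Qed.

(** * The plan carried by the graph of [4 T_mu]: marginal, support and moment *)

Section gradient_plan.
Variables (R : realType) (d : nat) (p : R) (mu : probability (Rd R d) R).
Hypotheses (p2 : 2 <= p) (hmu : finite_pmoment p mu).
Variable gam : probability (Rd R d * Rd R d)%type R.
Hypothesis hgam : forall A, measurable A ->
  gam A = mu ((fun x : Rd R d => (x, (4%:R *: Top mu x : Rd R d))) @^-1` A).
Local Notation V := 'rV[R]_d.

Lemma finite_pmoment_sq_integrable (nu : probability (Rd R d) R) :
  finite_pmoment p nu -> sq_integrable nu (fun x : Rd R d => x : V).
Proof.
move=> hnu; apply: (powR_integrable_sq_integrable p2).
  exact: measurable_coords_Rd.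
exact: finite_pmoment_integrable.
Qed.

Let smu := finite_pmoment_sq_integrable hmu.

Lemma plan_fst A : measurable A -> gam (fst @^-1` A) = mu A.
Proof.
by move=> mA; rewrite hgam// -[X in measurable X]setTI; exact: measurable_fst.
Qed.

Let M : 'M[R]_d := 4%:R *: (Smat mu - (\tr (Smat mu) / d%:R)%:M).

Lemma Top4E (x : V) : 4%:R *: Top mu x = (M *m x^T)^T.
Proof. by rewrite TopE// -scalemxAl linearZ. Qed.

Lemma measurable_coords_Top4 dT (T : measurableType dT) (X : T -> V) :
  measurable_coords X -> measurable_coords (fun t => 4%:R *: Top mu (X t)).
Proof.
by move=> mX; under eq_fun do rewrite Top4E; exact: measurable_coords_mulmx.
Qed.

(** The exceptional set is where the measurable real function [|w.2 - 4 T_mu w.1|^2] is nonzero. Its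
    preimage under the graph map is empty, so [hgam] gives it measure zero. *)
Lemma plan_ae : {ae gam, forall w, (w.2 : V) = 4%:R *: Top mu w.1}.
Proof.
pose g (w : Rd R d * Rd R d) : V := (w.2 : V) - 4%:R *: Top mu w.1.
have mg : measurable_coords g.
  apply: measurable_coordsB.
    by apply: measurable_coords_comp; exact: measurable_snd.
  by apply: measurable_coords_Top4; apply: measurable_coords_comp; exact: measurable_fst.
exists ((fun w => ip (g w) (g w)) @^-1` (~` [set 0])).
have mN : measurable ((fun w => ip (g w) (g w)) @^-1` (~` [set 0])).
  rewrite -[X in measurable X]setTI; apply: measurable_ip => //.
  exact: measurableC.
split => //.
  rewrite hgam//= (_ : _ @^-1` _ = set0) ?measure0// -subset0 => x; apply.
  by rewrite /g/= subrr /ip big1// => i _; rewrite mxE mul0r.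
move=> w; apply: contra_not => /= ipg0.
apply/matrixP => i j; apply/eqP; rewrite ord1 -subr_eq0.
have := coord_sqr_le_ip (g w) j; rewrite ipg0 /g !mxE => sq0.
by rewrite -sqrf_eq0 eq_le sq0 sqr_ge0.
Qed.

(** By [plan_ae] the integrand is almost everywhere a function of [w.1], so only the marginal [mu]
    enters; there the linear map [4 T_mu] is square-integrable and [q <= 2]. *)
Lemma plan_qmoment (q : R) : 0 <= q <= 2 ->
  (\int[gam]_w ((enorm (w.2 : V)) `^ q)%:E < +oo)%E.
Proof.
move=> q02.
have m1 : measurable_coords (fun w : Rd R d * Rd R d => (w.1 : V)).
  by apply: measurable_coords_comp; exact: measurable_fst.
have m2 : measurable_coords (fun w : Rd R d * Rd R d => (w.2 : V)).
  by apply: measurable_coords_comp; exact: measurable_snd.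
have mT := measurable_coords_Top4 (@measurable_coords_Rd R d).
rewrite (ge0_ae_eq_integral
  (g := fun w : Rd R d * Rd R d => (enorm (4%:R *: Top mu w.1) `^ q)%:E))//; first last.
- have [N [mN N0 sub]] := plan_ae; exists N; split => //.
  by apply: subset_trans sub; apply: subsetC => w /= ->.
- by move=> w _; rewrite lee_fin powR_ge0.
- by move=> w _; rewrite lee_fin powR_ge0.
- apply/measurable_EFinP/measurable_enorm_powR.
  exact: measurable_coords_Top4.
- by apply/measurable_EFinP/measurable_enorm_powR.
have mq := measurable_enorm_powR q mT.
have <- := ge0_integral_image measurable_fst plan_fst mq (fun=> powR_ge0 _ _).
have [_ sT] := sq_integrable_mulmx M smu.
have i1 := integrable_EFinD (integrable_EFin_cst mu 1) sT.
have /(integrable_lty measurableT) : mu.-integrable [set: Rd R d]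
    (EFin \o (fun x : Rd R d => enorm (4%:R *: Top mu x) `^ q)).
  apply: (integrable_le _ _ i1) => [|x]; first exact: measurable_enorm_powR.
  rewrite ger0_norm ?powR_ge0// Top4E -sqr_enorm.
  exact: powR_le_1Dsqr (enorm_ge0 _).
by [].
Qed.

End gradient_plan.

(** * The modulus bounding the remainder *)

(** The right-hand side of [bform_cross_moment_remainder], with [m] standing for the second moment
    of [mu]. *)
Definition remainder_modulus (R : realType) (d : nat) (m r : R) : R :=
  (d%:R ^+ 2 + d%:R) * (4 * m + (m + 2 + 2 * r) ^+ 2) * r ^+ 2.

Lemma continuous_modulus_factor (R : realType) (d : nat) (m : R) :
  continuous (fun r : R => (d%:R ^+ 2 + d%:R) * (4 * m + (m + 2 + 2 * r) ^+ 2)).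
Proof.
move=> r; apply: cvgM; first exact: cvg_cst.
apply: cvgD; first exact: cvg_cst.
by rewrite expr2; apply: cvgM; (apply: cvgD; [exact: cvg_cst|apply: cvgM;
  [exact: cvg_cst|exact: cvg_id]]).
Qed.

Lemma continuous_remainder_modulus (R : realType) (d : nat) (m : R) :
  continuous (remainder_modulus d m).
Proof.
move=> r; apply: cvgM; first exact: continuous_modulus_factor.
by rewrite expr2; apply: cvgM; exact: cvg_id.
Qed.

Lemma remainder_modulus_littleo (R : realType) (d : nat) (m : R) :
  (fun r => remainder_modulus d m r / r) @ 0^'+ --> 0.
Proof.
pose h (r : R) := (d%:R ^+ 2 + d%:R) * (4 * m + (m + 2 + 2 * r) ^+ 2).
have f0 : h r * r @[r --> 0] --> h 0 * 0.
  by apply: cvgM; [exact: continuous_modulus_factor|exact: cvg_id].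
rewrite mulr0 in f0.
apply: cvg_trans (cvg_at_right_filter f0); apply: near_eq_cvg.
(* To the right of 0 the division cancels one of the two factors [r], leaving [h r * r]. *)
near=> r; rewrite /=/h /remainder_modulus [r ^+ 2]expr2 mulrA mulfK// gt_eqF//.
Unshelve. all: by end_near. Qed.

(** * The first-order expansion along an arbitrary coupling [beta] *)

Section strong_differentiability.
Variables (R : realType) (d : nat) (p : R) (mu : probability (Rd R d) R).
Hypotheses (p2 : 2 <= p) (hmu : finite_pmoment p mu).
Variable gam : probability (Rd R d * Rd R d)%type R.
Hypothesis hgam : forall A, measurable A ->
  gam A = mu ((fun x : Rd R d => (x, (4%:R *: Top mu x : Rd R d))) @^-1` A).
Variable nu : probability (Rd R d) R.
Hypothesis hnu : finite_pmoment p nu.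
Variable beta : probability ((Rd R d * Rd R d) * Rd R d)%type R.
Hypothesis beta_fst : forall B, measurable B -> beta (fst @^-1` B) = gam B.
Hypothesis beta_snd : forall A, measurable A -> beta (snd @^-1` A) = nu A.
Local Notation V := 'rV[R]_d.
Local Notation T := ((Rd R d * Rd R d) * Rd R d)%type.

Let X (z : T) : V := z.1.1.
Let Y (z : T) : V := z.2.
Let H (z : T) : V := Y z - X z.

Let mfst1 : measurable_fun [set: T] (fun z : T => z.1.1).
Proof. exact: (measurableT_comp measurable_fst measurable_fst). Qed.

Let mX : measurable_coords X.
Proof. exact: (measurable_coords_comp mfst1). Qed.

Let mY : measurable_coords Y.
Proof. exact: (measurable_coords_comp measurable_snd). Qed.

Let mH : measurable_coords H := measurable_coordsB mY mX.

Let beta_mu A : measurable A -> beta ((fun z : T => z.1.1) @^-1` A) = mu A.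
Proof.
move=> mA; rewrite -(plan_fst hgam mA) -beta_fst//.
by rewrite -[X in measurable X]setTI; exact: measurable_fst.
Qed.

Let iX : beta.-integrable [set: T] (EFin \o (fun z => enorm (X z) `^ p)).
Proof.
have := integrable_image mfst1 beta_mu (measurable_enorm_powR p (@measurable_coords_Rd R d))
  (finite_pmoment_integrable hmu).
exact.
Qed.

Let iY : beta.-integrable [set: T] (EFin \o (fun z => enorm (Y z) `^ p)).
Proof.
have := integrable_image measurable_snd beta_snd (measurable_enorm_powR p (@measurable_coords_Rd R d))
  (finite_pmoment_integrable hnu).
exact.
Qed.

Let sX := powR_integrable_sq_integrable p2 mX iX.
Let sY := powR_integrable_sq_integrable p2 mY iY.
Let sH : sq_integrable beta H := sq_integrableB sY sX.
Let p0 : 0 <= p := le_trans (ler0n R 2) p2.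
Let iH := powR_integrableB p0 mY mX iY iX.
Let smu := finite_pmoment_sq_integrable p2 hmu.
Let snu := finite_pmoment_sq_integrable p2 hnu.

(** With [SmatY], this puts both second-moment matrices under the single law [beta], where
    [Y = X + H] can be expanded. *)
Let SmatX : Smat mu = cross_moment beta X X.
Proof.
apply/matrixP => i j; rewrite !mxE.
have mc := @measurable_coords_Rd R d.
exact: (Rintegral_image mfst1 beta_mu (measurable_funM (mc i) (mc j))
  (sq_integrable_mul i j smu smu)).
Qed.

Let SmatY : Smat nu = cross_moment beta Y Y.
Proof.
apply/matrixP => i j; rewrite !mxE.
have mc := @measurable_coords_Rd R d.
exact: (Rintegral_image measurable_snd beta_snd (measurable_funM (mc i) (mc j))
  (sq_integrable_mul i j snu snu)).
Qed.

Let M22X : M22 mu = \int[beta]_z ip (X z) (X z).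
Proof.
have mc := @measurable_coords_Rd R d.
by rewrite M22E; exact: (Rintegral_image mfst1 beta_mu (measurable_ip mc mc) (proj2 smu)).
Qed.

(** Almost everywhere [z.1.2] is [4 T_mu (X z)]; then [ip_dev] turns the pairing with [H] into
    [bform], and integration is linear. *)
Lemma first_order_term :
  \int[beta]_z ip (z.1.2 : V) (H z) =
  4 * bform (cross_moment beta X X) (cross_moment beta H X).
Proof.
have m2 : measurable_coords (fun z : T => z.1.2 : V).
  apply: measurable_coords_comp.
  exact: (measurableT_comp measurable_snd measurable_fst).
have mT : measurable_coords (fun z : T => 4%:R *: Top mu (X z)).
  exact: (measurable_coords_Top4 p2 hmu).
transitivity (\int[beta]_z ip (4%:R *: Top mu (X z)) (H z)).
  congr fine; apply: ae_eq_integral => //.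
  - exact/measurable_EFinP/measurable_ip.
  - exact/measurable_EFinP/measurable_ip.
  - have [N [mN N0 sub]] := plan_ae p2 hmu hgam.
    (* A [gam]-null set pulls back to a [beta]-null set because [gam] is the marginal of [beta]
       under [fst]. *)
    exists (fst @^-1` N); split.
    + by rewrite -[X in measurable X]setTI; exact: measurable_fst.
    + exact: etrans (beta_fst mN) N0.
    + move=> z; apply: contra_notP => /= Nz _.
      have -> // : (z.1.2 : V) = 4%:R *: Top mu z.1.1.
      by apply: contrapT => /(sub z.1).
rewrite -Rintegral_bform_cross// -RintegralZl//; last exact: integrable_bform_cross.
apply: eq_Rintegral => z _.
rewrite -SmatX -ip_dev -TopE// /ip mulr_sumr.
by apply: eq_bigr => i _; rewrite mulrA; congr (_ * _); rewrite mxE.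
Qed.

Lemma TP_remainder_le (s : R) : 0 < s -> Cpb p beta <= s ->
  `|TP nu - TP mu - \int[beta]_z ip (z.1.2 : V) (H z)| <=
    remainder_modulus d (M22 mu) s.
Proof.
move=> s0 Cs; rewrite !TP_bform// first_order_term SmatX SmatY M22X.
apply: bform_cross_moment_remainder => //.
  by move=> z; rewrite /H addrC subrK.
apply: (second_moment_le p2) => //.
have pp : 0 < p by rewrite (lt_le_trans _ p2).
(* [Cpb] is defined with [x1 - x3], the opposite of [H]. *)
have -> : \int[beta]_z enorm (H z) `^ p = \int[beta]_z enorm (X z - Y z) `^ p.
  apply: eq_Rintegral => z _; congr (_ `^ _); rewrite /enorm; congr Num.sqrt.
  by apply: eq_bigr => i _; rewrite !mxE; ring.
have I0 : 0 <= \int[beta]_z enorm (X z - Y z) `^ p.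
  by apply: Rintegral_ge0 => z _; exact: powR_ge0.
(* The integral is rewritten as the [p]-th power of its [p]-th root [Cpb], then compared with [s] by
   monotonicity. *)
rewrite -[leLHS]powRr1// -(mulVf (lt0r_neq0 pp)) powRrM.
by apply: ge0_ler_powR; rewrite ?nnegrE ?powR_ge0// ltW.
Qed.

(** Every [s] above [Cpb p beta] is positive, so [TP_remainder_le] applies; continuity of the
    modulus carries the bound to the limit. *)
Lemma TP_remainder_Cpb :
  `|TP nu - TP mu - \int[beta]_z ip (z.1.2 : V) (H z)| <=
    remainder_modulus d (M22 mu) (Cpb p beta).
Proof.
have c : remainder_modulus d (M22 mu) s @[s --> (Cpb p beta)^'+] -->
    remainder_modulus d (M22 mu) (Cpb p beta).
  exact: cvg_at_right_filter (@continuous_remainder_modulus R d (M22 mu) _).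
apply: (cvgr_to_ge c).
near=> s; have Cs : Cpb p beta < s by near: s; exact: nbhs_right_gt.
by apply: TP_remainder_le (ltW Cs); rewrite (le_lt_trans _ Cs)// powR_ge0.
Unshelve. all: by end_near. Qed.

End strong_differentiability.

Theorem mainTheorem7 (R : realType) (d : nat) (p : R) (hp : 2 <= p)
  (mu : probability (Rd R d) R) (hmu : finite_pmoment p mu)
  (gam : probability (Rd R d * Rd R d)%type R)
  (hgam : forall A, measurable A ->
     gam A = mu ((fun x : Rd R d => (x, (4%:R *: Top mu x : Rd R d))) @^-1` A)) :
  strongly_differentiable p (@TP R d) mu gam.
Proof.
have p0 : 0 < p - 1 by lra.
split; first by move=> A mA; exact: (plan_fst hgam).
split.
  apply: (plan_qmoment hp hmu hgam); apply/andP; split.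
    by rewrite divr_ge0 ?(ltW p0)// (le_trans _ hp).
  (* The bound [q <= 2] amounts to [p <= 2 (p - 1)], that is, [p >= 2]. *)
  by rewrite ler_pdivrMr//; lra.
exists (remainder_modulus d (M22 mu)); split; first exact: remainder_modulus_littleo.
by move=> nu hnu beta bgam bnu; exact: (TP_remainder_Cpb hp hmu hgam hnu bgam bnu).
Qed.
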